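(* (1) The critical cardinalities of the following properties are all equal to $\mathfrak{d}$: the Menger property, Menger-boundedness (for sets or for groups), the Scheepers property, and Scheepers-boundedness (for sets or for groups). (2) The critical cardinalities of the Hurewicz property and of Hurewicz-boundedness (for sets or for groups) are equal to $\mathfrak{b}$. (3) The critical cardinalities of the Rothberger property and of Rothberger-boundedness (for sets or for groups) are equal to $\operatorname{cov}(\mathcal{M})$.
   Context: $\mathbb{N}=\{0,1,2,\dots\}$, $[0,m)=\{0,\dots,m-1\}$, $\mathbb{Z}^{<\aleph_0}$ is the set of finite sequences of integers, and $\mathbb{Z}^{\mathbb{N}}$ has pointwise addition and the product topology ($\mathbb{Z}$ discrete). The critical cardinality of a property $P$ of subsets of $\mathbb{Z}^{\mathbb{N}}$ is $\operatorname{non}(P)=\min\{|X|: X\subseteq\mathbb{Z}^{\mathbb{N}}\text{ and }X\text{ does not satisfy }P\}$; ''for groups'' means that the minimum is taken over subgroups $X$ of $\mathbb{Z}^{\mathbb{N}}$ not satisfying $P$, with the group definitions below. Cardinals. For $f,g\in\mathbb{N}^{\mathbb{N}}$, $f\le^* g$ means $f(n)\le g(n)$ for all but finitely many $n$. $\mathfrak{b}$ is the minimal cardinality of a subset of $\mathbb{N}^{\mathbb{N}}$ that is $\le^*$-unbounded; $\mathfrak{d}$ is the minimal cardinality of a dominating $D\subseteq\mathbb{N}^{\mathbb{N}}$ (for each $g\in\mathbb{N}^{\mathbb{N}}$ there is $f\in D$ with $g\le^* f$); $\operatorname{cov}(\mathcal{M})$ is the minimal cardinality of $Y\subseteq\mathbb{N}^{\mathbb{N}}$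 such that there is no $f\in\mathbb{N}^{\mathbb{N}}$ with the property that for each $y\in Y$, $f(n)=y(n)$ for some $n$ (equivalently, the minimal cardinality of a cover of $\mathbb{R}$ by meager sets). Topological properties of a space $X$. Menger: for each sequence $(\mathcal{U}_n)_{n\in\mathbb{N}}$ of open covers of $X$ there are finite $\mathcal{F}_n\subseteq\mathcal{U}_n$ such that $\bigcup_n\mathcal{F}_n$ covers $X$. Scheepers: for each such sequence there are finite $\mathcal{F}_n\subseteq\mathcal{U}_n$ such that for each finite $F\subseteq X$ there is $n$ with $F\subseteq\bigcup_{U\in\mathcal{F}_n}U$. Hurewicz: for each such sequence there are finite $\mathcal{F}_n\subseteq\mathcal{U}_n$ such that for each $x\in X$, $x\in\bigcup_{U\in\mathcal{F}_n}U$ for all but finitely many $n$. Rothberger: for each such sequence there are $U_n\in\mathcal{U}_n$ with $X=\bigcup_n U_n$. Boundedness for sets $X\subseteq\mathbb{Z}^{\mathbb{N}}$. Menger-bounded: there is $f\in\mathbb{N}^{\mathbb{N}}$ such that for every $g\in X$ there are infinitely many $n$ with $|g(k)|\le f(n)$ for all $k<n$. Scheepers-bounded: there is $f\in\mathbb{N}^{\mathbb{N}}$ such that for every finite $F\subseteq X$ there are infinitely many $n$ such that $|g(k)|\le f(n)$ for all $g\in F$, $k<n$. Hurewicz-bounded: there is $f\in\mathbb{N}^{\mathbb{N}}$ such that for every $g\in X$, $|g(n)|\le f(n)$ for all but finitely many $n$. Rothberger-bounded: for each strictly increasing $h\in\mathbb{N}^{\mathbb{N}}$ there is $\varphi:\mathbb{N}\to\mathbb{Z}^{<\aleph_0}$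 such that for every $g\in X$ there is $n$ with $g\upharpoonright[0,h(n))=\varphi(n)$. Boundedness for topological groups $G$. For each sequence $(U_n)_{n\in\mathbb{N}}$ of neighborhoods of the unit: Menger-bounded: there are finite $F_n\subseteq G$ with $G=\bigcup_nF_n\cdot U_n$; Scheepers-bounded: there are finite $F_n\subseteq G$ such that each finite $F\subseteq G$ is contained in $F_n\cdot U_n$ for some $n$; Hurewicz-bounded: there are finite $F_n\subseteq G$ such that each $g\in G$ belongs to $F_n\cdot U_n$ for all but finitely many $n$; Rothberger-bounded: there are $a_n\in G$ with $G=\bigcup_n a_n\cdot U_n$. *)

(* Defs.v *)
From HB Require Import structures.
From mathcomp Require Import all_boot all_order all_algebra.
From mathcomp Require Import all_classical topology tvs.

Set Implicit Arguments.
Unset Strict Implicit.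
Unset Printing Implicit Defensive.

Import GRing.Theory.

Local Open Scope classical_set_scope.
Local Open Scope card_scope.
Local Open Scope ring_scope.

(* Cardinals are represented by sets up to equipotence: K has the minimal
   cardinality of a member of the family C. *)
Definition is_min_card {T U : Type} (C : set (set T)) (K : set U) : Prop :=
  (exists2 A, C A & A #= K) /\ (forall A, C A -> K #<= A).

Definition le_star (f g : nat -> nat) : Prop :=
  \forall n \near \oo, (f n <= g n)%N.

Definition unbounded_family (B : set (nat -> nat)) : Prop :=
  ~ exists g, forall f, B f -> le_star f g.

Definition dominating_family (D : set (nat -> nat)) : Prop :=
  forall g, exists2 f, D f & le_star g f.

(* The minimal cardinality of such a family is cov(M), the minimal number of
   meager sets covering the real line. *)
Definition unguessable_family (Y : set (nat -> nat)) : Prop :=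
  ~ exists f : nat -> nat, forall y, Y y -> exists n, f n = y n.

Definition is_b (K : set (nat -> nat)) : Prop := is_min_card unbounded_family K.

Definition is_d (K : set (nat -> nat)) : Prop := is_min_card dominating_family K.

Definition is_cov_meager (K : set (nat -> nat)) : Prop :=
  is_min_card unguessable_family K.

Definition ZN : Type := prod_topology (fun _ : nat => discrete_topology int).

HB.instance Definition _ := Topological.on ZN.
HB.instance Definition _ := GRing.Zmodule.copy ZN (nat -> int).

Lemma nbhs_ZN_coord (f : ZN) (k : nat) : nbhs f [set g : ZN | g k = f k].
Proof.
apply: (@proj_continuous nat (fun=> discrete_topology int) k f [set f k]).
exact: discrete_set1.
Qed.

Lemma ZN_sub_continuous : continuous (fun p : ZN * ZN => p.1 - p.2).
Proof.
move=> p; apply/cvg_sup => k U [B] [[C _ <-]] /= pC CU.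
exists ([set g : ZN | g k = p.1 k], [set g : ZN | g k = p.2 k]).
  by split; exact: nbhs_ZN_coord.
move=> [a b] /= [ak bk]; apply: CU => /=.
suff -> : (a - b) k = (p.1 - p.2) k by [].
by rewrite /= -[LHS]/(a k - b k) -[RHS]/(p.1 k - p.2 k) ak bk.
Qed.

HB.instance Definition _ :=
  PreTopologicalNmodule_isTopologicalZmodule.Build ZN ZN_sub_continuous.

Definition subgroup (G : zmodClosed ZN) : Type := {g : ZN | g \in G}.

HB.instance Definition _ (G : zmodClosed ZN) := SubChoice.on (subgroup G).
HB.instance Definition _ (G : zmodClosed ZN) :=
  [SubChoice_isSubZmodule of subgroup G by <:].
HB.instance Definition _ (G : zmodClosed ZN) :=
  Topological.copy (subgroup G)
    (initial_topology (\val : {g : ZN | g \in G} -> ZN)).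

Lemma subgroup_sub_continuous (G : zmodClosed ZN) :
  continuous (fun p : subgroup G * subgroup G => p.1 - p.2).
Proof.
have cval : continuous (\val : subgroup G -> ZN).
  exact: initial_continuous.
apply: (@continuous_comp_initial _ _ _ (\val : {g : ZN | g \in G} -> ZN)).
move=> p; rewrite (_ : _ \o _ = (fun q : ZN * ZN => q.1 - q.2) \o
  (fun p : subgroup G * subgroup G => (\val p.1 : ZN, \val p.2 : ZN))); last first.
  by [].
apply: continuous_comp; last exact: ZN_sub_continuous.
have c1 : (\val q.1 : ZN) @[q --> p] --> (\val p.1 : ZN).
  by apply: (continuous_comp cvg_fst); exact: cval.
have c2 : (\val q.2 : ZN) @[q --> p] --> (\val p.2 : ZN).
  by apply: (continuous_comp cvg_snd); exact: cval.
exact: cvg_pair c1 c2.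
Qed.

HB.instance Definition _ (G : zmodClosed ZN) :=
  PreTopologicalNmodule_isTopologicalZmodule.Build (subgroup G)
    (@subgroup_sub_continuous G).

Definition non (P : set ZN -> Prop) : set (set ZN) := [set X | ~ P X].

(* X carries the subspace topology of ZN. *)
Definition non_space (P : topologicalType -> Prop) : set (set ZN) :=
  [set X : set ZN | ~ P X].

Definition non_grp (P : topologicalZmodType -> Prop) : set (set ZN) :=
  [set X | exists2 G : zmodClosed ZN, [set` G] = X & ~ P (subgroup G)].

Section spaces.
Variable X : topologicalType.

(* The empty family is not counted as a cover of the empty space; otherwise the
   empty space would fail to be Rothberger. *)
Definition open_cover (U : set (set X)) : Prop :=
  [/\ U !=set0, U `<=` open & \bigcup_(V in U) V = setT].

Definition Menger : Prop :=
  forall U : nat -> set (set X), (forall n, open_cover (U n)) ->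
  exists F : nat -> set (set X),
    (forall n, finite_set (F n) /\ F n `<=` U n) /\
    \bigcup_n \bigcup_(V in F n) V = setT.

Definition Scheepers : Prop :=
  forall U : nat -> set (set X), (forall n, open_cover (U n)) ->
  exists F : nat -> set (set X),
    (forall n, finite_set (F n) /\ F n `<=` U n) /\
    forall E : set X, finite_set E -> exists n, E `<=` \bigcup_(V in F n) V.

Definition Hurewicz : Prop :=
  forall U : nat -> set (set X), (forall n, open_cover (U n)) ->
  exists F : nat -> set (set X),
    (forall n, finite_set (F n) /\ F n `<=` U n) /\
    forall x : X, \forall n \near \oo, (\bigcup_(V in F n) V) x.

Definition Rothberger : Prop :=
  forall U : nat -> set (set X), (forall n, open_cover (U n)) ->
  exists V : nat -> set X, (forall n, U n (V n)) /\ \bigcup_n V n = setT.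

End spaces.

Section sets.
Variable X : set ZN.

Definition Menger_bounded : Prop :=
  exists f : nat -> nat, forall g, X g ->
    infinite_set [set n | forall k, (k < n)%N -> (absz (g k) <= f n)%N].

Definition Scheepers_bounded : Prop :=
  exists f : nat -> nat, forall F : set ZN, finite_set F -> F `<=` X ->
    infinite_set
      [set n | forall g k, F g -> (k < n)%N -> (absz (g k) <= f n)%N].

Definition Hurewicz_bounded : Prop :=
  exists f : nat -> nat, forall g, X g ->
    \forall n \near \oo, (absz (g n) <= f n)%N.

Definition Rothberger_bounded : Prop :=
  forall h : nat -> nat, {homo h : m n / (m < n)%N} ->
  exists phi : nat -> seq int, forall g, X g ->
    exists n, mkseq g (h n) = phi n.

End sets.

Section groups.
Variable G : topologicalZmodType.

Definition translates (F U : set G) : set G := [set a + u | a in F & u in U].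

Definition grp_Menger_bounded : Prop :=
  forall U : nat -> set G, (forall n, nbhs (0 : G) (U n)) ->
  exists F : nat -> set G, (forall n, finite_set (F n)) /\
    \bigcup_n translates (F n) (U n) = setT.

Definition grp_Scheepers_bounded : Prop :=
  forall U : nat -> set G, (forall n, nbhs (0 : G) (U n)) ->
  exists F : nat -> set G, (forall n, finite_set (F n)) /\
    forall E : set G, finite_set E ->
      exists n, E `<=` translates (F n) (U n).

Definition grp_Hurewicz_bounded : Prop :=
  forall U : nat -> set G, (forall n, nbhs (0 : G) (U n)) ->
  exists F : nat -> set G, (forall n, finite_set (F n)) /\
    forall g : G, \forall n \near \oo, translates (F n) (U n) g.

Definition grp_Rothberger_bounded : Prop :=
  forall U : nat -> set G, (forall n, nbhs (0 : G) (U n)) ->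
  exists a : nat -> G, \bigcup_n translates [set a n] (U n) = setT.

End groups.

(* Main.v *)
From HB Require Import structures.
Require Import Defs.
From mathcomp Require Import all_boot all_order all_algebra.
From mathcomp Require Import all_classical topology tvs.

(* Coding the initial segments of [x] in [X] by natural numbers, a sequence of
   open covers (or of neighbourhoods of 0) assigns to each [x] a function
   [phi x], whose value at [n] is the code of an initial segment whose cylinder
   lies in one member of the [n]-th cover.  A failure of the Hurewicz (resp.
   Rothberger) property makes [{phi x}] unbounded (resp. unguessable).  A failure
   of the Menger property is also one of the Scheepers property, which makes the
   pointwise maxima of the [phi x] over the finite subsets of [X] dominating;
   there are at most [|X|] such maxima, as [X] is then infinite.

   Conversely, a family witnessing the cardinal fails the corresponding
   boundedness property for sets, and so does the subgroup it generates, which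
   has the same cardinality.  As a space and as a group, that subgroup fails all
   the properties, since each of them implies boundedness for sets. *)

Set Implicit Arguments.
Unset Strict Implicit.
Unset Printing Implicit Defensive.

Import GRing.Theory.

Local Open Scope classical_set_scope.
Local Open Scope card_scope.

(** * Cardinals *)

Lemma card_le_inj {T U : Type} (A : set T) (B : set U) (f : T -> U) :
  (forall x, A x -> B (f x)) ->
  (forall x y, A x -> A y -> f x = f y -> x = y) -> A #<= B.
Proof.
move=> fAB finj; have <- : (f @` A #<= B) = (A #<= B).
  apply: card_le_eql; apply: inj_card_eq => x y /set_mem Ax /set_mem Ay.
  exact: finj.
by apply: subset_card_le => _ [x Ax <-]; exact: fAB.
Qed.

Lemma card_le_injP {T U : Type} (A : set T) (B : set U) (u0 : U) :
  A #<= B -> exists f : T -> U, (forall x, A x -> B (f x)) /\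
    (forall x y, A x -> A y -> f x = f y -> x = y).
Proof.
move=> /card_leP[f].
pose g x := if pselect (A x) is left Ax
            then set_val (f (exist _ x (mem_set Ax))) else u0.
exists g; split=> [x Ax|x y Ax Ay]; rewrite /g.
  by case: pselect => // Ax'; exact: set_valP.
case: pselect => // Ax'; case: pselect => // Ay' /val_inj.
by move=> /(@inj _ _ _ f) H; have := H (mem_set I) (mem_set I) => -[].
Qed.

(* A maximal set of choice functions on which every projection is injective
   must project onto some [A i]. *)
Lemma exists_card_min {I T : Type} (i0 : I) (A : I -> set T) :
  exists i, forall j, A i #<= A j.
Proof.
pose P (S : set (I -> T)) := (forall p, S p -> forall i, A i (p i)) /\
  forall i p q, S p -> S q -> p i = q i -> p = q.
have [F FP Ftot|S [[SA Sinj] Smax]] := @Zorn_bigcup _ P.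
  split=> [p [S FS Sp]|i p q [S FS Sp] [S' FS' Sq]].
    exact: (FP _ FS).1.
  by have [SS'|S'S] := Ftot _ _ FS FS'; [apply: (FP _ FS').2 => //; exact: SS'
                                       | apply: (FP _ FS).2 => //; exact: S'S].
apply: contrapT => /forallNP Amin.
(* If the [i]-th projection of [S] were onto [A i], then [A i] would inject into every [A j] by
   inverting it and projecting to [j]. So every projection misses a point, and a function made of
   missed points can be added to [S], against maximality. *)
have missed i : exists x, A i x /\ forall p, S p -> p i <> x.
  apply: contrapT => /forallNP h; apply: (Amin i) => j.
  apply: (@card_le_trans _ _ _ S).
    apply: (@card_le_trans _ _ _ ((fun p => p i) @` S)); last exact: card_image_le.
    apply: subset_card_le => x Ax; apply: contrapT => nx; apply: (h x).
    by split=> // p Sp pix; apply: nx; exists p.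
  by apply: (@card_le_inj _ _ _ _ (fun p => p j)) => [p /SA|p q] //; exact: Sinj.
have {missed}[p pP] := choice missed.
apply: (Smax (S `|` [set p])).
  split; first by move=> q; left.
  by move=> /(_ p (or_intror erefl)) Sp; exact: ((pP i0).2 _ Sp).
split=> [q [/SA//|-> i]|i q q' [Sq|->] [Sq'|->]//]; first exact: (pP i).1.
- exact: Sinj.
- by move=> /((pP i).2 _ Sq).
- by move=> /esym/((pP i).2 _ Sq').
Qed.

Lemma card_le_total {T : Type} (A B : set T) : A #<= B \/ B #<= A.
Proof.
have [[] h] := exists_card_min true (fun b : bool => if b then A else B).
  by left; exact: (h false).
by right; exact: (h true).
Qed.

(** * Finite sequences over an infinite set *)

Definition seqs {T : Type} (A : set T) : set (seq T) :=
  [set s | all (fun x => x \in A) s].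

Lemma seqs_cons {T : Type} (A : set T) x s : seqs A (x :: s) <-> A x /\ seqs A s.
Proof.
rewrite /seqs /=; split=> [/andP[/set_mem ? ?]//|[Ax ->]].
by rewrite mem_set.
Qed.

Lemma seqsS {T : Type} (A B : set T) : A `<=` B -> seqs A `<=` seqs B.
Proof. by move=> AB s; apply: sub_all => x /set_mem /AB /mem_set. Qed.

Lemma seqsT {T : Type} (s : seq T) : seqs [set: T] s.
Proof. by elim: s => // x s IH; apply/seqs_cons. Qed.

(* An injection of the nonempty sequences of [B] into [B] makes room for two
   tagged copies of [B]. *)
Lemma seqs_card_le_step {T : Type} (B D : set T) (f : seq T -> T) :
  B !=set0 -> (forall s, s <> [::] -> seqs B s -> B (f s)) ->
  (forall s t, s <> [::] -> t <> [::] -> seqs B s -> seqs B t ->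
    f s = f t -> s = t) ->
  D `\` B #<= B -> seqs D #<= B.
Proof.
move=> [b Bb] fB finj /(card_le_injP b)[g [gB ginj]].
pose c0 := f [:: b]; pose c1 := f [:: b; b].
have seqb : seqs B [:: b] by apply/seqs_cons.
have seqbb : seqs B [:: b; b] by apply/seqs_cons.
have c01 : c0 <> c1.
  by move=> /(fun e => finj [:: b] [:: b; b] _ _ seqb seqbb e)-/(_ _ _)[].
have Bc0 : B c0 by exact: fB.
have Bc1 : B c1 by exact: fB.
(* The tags [c0] and [c1] mark which copy of [B] holds the code: the points of [B] themselves, or
   the images under [g] of the points of [D] outside [B]. *)
pose code x := if x \in B then (c0, x) else (c1, g x).
have codeB x : D x -> B (code x).1 /\ B (code x).2.
  move=> Dx; rewrite /code; case: (boolP (x \in B)) => /=.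
    by move=> /set_mem.
  by move=> /negP xB; split => //; apply: gB; split => // Bx; apply/xB/mem_set.
have codeI x y : D x -> D y -> code x = code y -> x = y.
  move=> Dx Dy; rewrite /code.
  case: (boolP (x \in B)); case: (boolP (y \in B)) => //.
  - by move=> _ _ [].
  - by move=> _ _ [/c01].
  - by move=> _ _ [/esym/c01].
  - move=> /negP yB /negP xB [] /ginj; apply; split=> //.
      by move=> /mem_set.
    by move=> /mem_set.
(* Every point takes exactly two entries, so the flattened sequence can be decoded; the [b] put in
   front below keeps it nonempty, as [f] is controlled only there. *)
pose fl s := flatten [seq [:: (code x).1; (code x).2] | x <- s].
apply: (@card_le_inj _ _ _ _ (fun s => f (b :: fl s))).
  move=> s Ds; apply: fB => //; apply/seqs_cons; split => //.
  elim: s Ds => [//|x s IH] /seqs_cons[/codeB[? ?] /IH ?] /=.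
  by apply/seqs_cons; split => //; apply/seqs_cons.
have flB s : seqs D s -> seqs B (b :: fl s).
  move=> Ds; apply/seqs_cons; split => //.
  elim: s Ds => [//|x s IH] /seqs_cons[/codeB[? ?] /IH ?] /=.
  by apply/seqs_cons; split => //; apply/seqs_cons.
move=> s t Ds Dt /(fun e => finj _ _ _ _ (flB _ Ds) (flB _ Dt) e)-/(_ _ _)[] //.
elim: s t Ds Dt => [|x s IH] [|y t] //= /seqs_cons[Dx Ds] /seqs_cons[Dy Dt].
rewrite /fl /= => -[xy1 xy2 /(congr1 (cons b)) /(IH _ Ds Dt) ->].
congr (_ :: _); apply: codeI => //.
by rewrite [LHS]surjective_pairing [RHS]surjective_pairing xy1 xy2.
Qed.

Lemma seq_inj_of_nat_inj {T : Type} (e : nat -> T) : injective e ->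
  exists f : seq T -> T, injective f.
Proof.
(* Zorn on the graphs [G] of injections of the nonempty sequences of [dom G]
   into [dom G]; a maximal such [dom G] is at least as large as its complement,
   since otherwise a copy of [dom G] disjoint from it could be added. *)
move=> einj.
pose dom (G : set (seq T * T)) := [set x | exists y, G ([:: x], y)].
pose P (G : set (seq T * T)) :=
  [/\ forall s y, G (s, y) -> [/\ s <> [::], seqs (dom G) s & dom G y],
      forall s, s <> [::] -> seqs (dom G) s -> exists y, G (s, y),
      forall s y z, G (s, y) -> G (s, z) -> y = z &
      forall s t y, G (s, y) -> G (t, y) -> s = t].
have domS G H : G `<=` H -> dom G `<=` dom H.
  by move=> GH x [y /GH ?]; exists y.
have [F FP Ftot|G [GP Gmax]] := @Zorn_bigcup _ P.
  have pair a b : (\bigcup_(X in F) X) a -> (\bigcup_(X in F) X) b ->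
      exists X, [/\ F X, X a & X b].
    move=> [X FX Xa] [Y FY Yb]; have [XY|YX] := Ftot _ _ FX FY.
      by exists Y; split => //; exact: XY.
    by exists X; split => //; exact: YX.
  split.
  - move=> s y [X FX Xsy]; have [Xnil _ _ _] := FP _ FX.
    have [sN Xs Xdy] := Xnil _ _ Xsy.
    have XF : X `<=` \bigcup_(X in F) X by move=> z Xz; exists X.
    by split => //; [exact: (seqsS (domS _ _ XF) Xs)|exact: (domS _ _ XF _ Xdy)].
  - move=> s sN Fs.
    (* The finitely many entries of [s] lie in domains of members of the chain, hence all in the
       domain of the largest of these members. *)
    have [X FX Xs] : exists2 X, F X & seqs (dom X) s.
      elim: s sN Fs => [//|x [|x' s] IH] _ /seqs_cons[[y [X FX Xxy]] Fs].
        by exists X => //; apply/seqs_cons; split => //; exists y.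
      have [|Y FY Ys] := IH _ Fs; first by [].
      have [XY|YX] := Ftot _ _ FX FY.
        by exists Y => //; apply/seqs_cons; split => //; exists y; exact: XY.
      exists X => //; apply/seqs_cons; split; first by exists y.
      exact: (seqsS (domS _ _ YX) Ys).
    have [_ /(_ _ sN Xs)[y Xsy] _ _] := FP _ FX.
    by exists y; exists X.
  - move=> s y z Fy Fz; have [X [FX Xy Xz]] := pair _ _ Fy Fz.
    by have [_ _ h _] := FP _ FX; exact: h Xy Xz.
  - move=> s t y Fs Ft; have [X [FX Xs Xt]] := pair _ _ Fs Ft.
    by have [_ _ _ h] := FP _ FX; exact: h Xs Xt.
have [GB Gtot Gfun Ginj] := GP.
(* With empty domain, [G] itself would be empty, since its values lie in [dom G]; the graph [G0] of
   a coding of the sequences over the range of [e] would then extend it properly. *)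
have [b Bb] : dom G !=set0.
  apply: contrapT => B0.
  pose G0 := [set sy : seq T * T | exists2 u : seq nat, u <> [::] &
    sy = (map e u, e (choice.pickle u))].
  apply: (Gmax G0).
    have GG0 sy : ~ G sy.
      by case: sy => s y /GB[_ _ ?]; apply: B0; exists y.
    split; first by move=> sy /GG0.
    move=> /(_ ([:: e 0], e (choice.pickle [:: 0]))) G0G.
    by apply: (GG0 _ (G0G _)); exists [:: 0].
  have domG0 x : dom G0 x <-> range e x.
    split=> [[y [[|n [|? ?]] // _ []] -> _]|[n _ <-]]; first by exists n.
    by exists (e (choice.pickle [:: n])), [:: n].
  split.
  - move=> s y [u uN [-> ->]]; split.
    + by case: u uN.
    + elim: u {uN} => [//|n u IH] /=; apply/seqs_cons; split => //.
      by apply/domG0; exists n.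
    + by apply/domG0; exists (choice.pickle u).
  - move=> s sN Gs.
    suff [u su] : exists u, s = map e u.
      exists (e (choice.pickle u)), u; last by rewrite su.
      by move=> u0; apply: sN; rewrite su u0.
    elim: s Gs {sN} => [|x s IH]; first by exists [::].
    by move=> /seqs_cons[/domG0[n _ <-] /IH[u ->]]; exists (n :: u).
  - move=> s y z [u _ [-> ->]] [v _ [/(inj_map einj) -> ->]] //.
  - move=> s t y [u _ [-> ->]] [v _ [-> /einj/(pcan_inj choice.pickleK) ->]] //.
have /choice[f fP] s : exists y, s <> [::] -> seqs (dom G) s -> G (s, y).
  case: (pselect (s <> [::] /\ seqs (dom G) s)) => [[sN Gs]|nGs].
    by have [y ?] := Gtot _ sN Gs; exists y.
  by exists b => sN Gs; case: nGs.
set B := dom G in GB Gtot Bb fP.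
have fB s : s <> [::] -> seqs B s -> B (f s).
  by move=> sN Bs; have [] := GB _ _ (fP _ sN Bs).
have finj s t : s <> [::] -> t <> [::] -> seqs B s -> seqs B t ->
    f s = f t -> s = t.
  move=> sN tN Bs Bt fst; apply: (Ginj _ _ (f s)); first exact: fP.
  by rewrite fst; exact: fP.
have B0 : B !=set0 by exists b.
(* If the complement of [B] is no larger than [B], the previous lemma with [D] the whole type gives
   the injection. *)
have [BCB|BBC] := card_le_total (~` B) B.
  have /(card_le_injP b)[h [_ hinj]] : seqs [set: T] #<= B.
    by apply: (seqs_card_le_step B0 fB finj); rewrite setTD.
  by exists h => s t; apply: hinj; exact: seqsT.
(* Otherwise [g] places a copy of [B] in the complement. The sequences over [D] with an entry
   outside [B] can be sent injectively into this copy, where no value of [G] lies, and this extends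
   [G]. *)
have [g [gB ginj]] := card_le_injP b BBC.
pose D := B `|` g @` B.
have DBB : D `\` B #<= B.
  apply: (@card_le_trans _ _ _ (g @` B)); last exact: card_image_le.
  by apply: subset_card_le => x [[]].
have [h [hB hinj]] := card_le_injP b (seqs_card_le_step B0 fB finj DBB).
pose G' := [set sy : seq T * T | [/\ sy.1 <> [::], seqs D sy.1, ~ seqs B sy.1 &
  sy.2 = g (h sy.1)]].
have domGG' : dom (G `|` G') = D.
  apply/seteqP; split => [x [y [Gxy|[_ /seqs_cons[]//]]]|x].
    by left; exists y.
  have [Bx _|nBx Dx] := pselect (B x).
    by have [y ?] := Bx; exists y; left.
  exists (g (h [:: x])); right; split => //.
  - exact/seqs_cons.
  - by move=> /seqs_cons[].
have G'nB s y : G' (s, y) -> ~ B y.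
  by move=> [/= _ Ds _ ->]; apply: gB; exact: hB.
exfalso; apply: (Gmax (G `|` G')).
  split; first by left.
  move=> /(_ ([:: g b], g (h [:: g b]))) H.
  have nBgb : ~ B (g b) by exact: gB.
  apply: (nBgb); exists (g (h [:: g b])); apply: H; right; split => //.
  - by apply/seqs_cons; split => //; right; exists b.
  - by move=> /seqs_cons[].
split; rewrite ?domGG'.
- move=> s y [/GB[sN Bs By]|[/= sN Ds _ ->]].
    by split => //; [apply: seqsS Bs; left|left].
  by split => //; right; exists (h s) => //; exact: hB.
- move=> s sN Ds; have [Bs|nBs] := pselect (seqs B s).
    by have [y ?] := Gtot _ sN Bs; exists y; left.
  by exists (g (h s)); right.
- move=> s y z [Gy|[/= _ _ nBs ->]] [Gz|[/= _ _ nBs' ->]] //.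
  + exact: Gfun Gy Gz.
  + by case: nBs'; have [] := GB _ _ Gy.
  + by case: nBs; have [] := GB _ _ Gz.
- move=> s t y [Gs|G's] [Gt|G't].
  + exact: Ginj Gs Gt.
  + by case: (G'nB _ _ G't); have [] := GB _ _ Gs.
  + by case: (G'nB _ _ G's); have [] := GB _ _ Gt.
  + move: G's G't => [/= _ Ds _ ->] [/= _ Dt _ /ginj hst].
    by apply: hinj => //; apply: hst; exact: hB.
Qed.

Lemma seqs_card_le {T : Type} (A : set T) : infinite_set A -> seqs A #<= A.
Proof.
move=> Ainf; have [a0 Aa0] := infinite_setN0 Ainf.
have /infiniteP/(card_le_injP a0)[e [eA einj]] := Ainf.
(* The injection of sequences was built for whole types, so it is applied to the type of elements of
   [A]. *)
pose e' n : A := exist _ (e n) (mem_set (eA n I)).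
have [|f finj] := @seq_inj_of_nat_inj _ e'.
  by move=> m n /(congr1 val)/= /einj; exact.
apply: (@card_le_trans _ _ _ [set: seq A]).
  apply: (@card_le_trans _ _ _ (map val @` [set: seq A])); last exact: card_image_le.
  apply: subset_card_le; elim=> [|x s IH]; first by exists [::].
  move=> /seqs_cons[Ax /IH[u _ <-]]; exists (exist _ x (mem_set Ax) :: u) => //.
apply: (@card_le_trans _ _ _ [set: A]); last by rewrite (card_le_eql (card_setT A)).
by apply: (@card_le_inj _ _ _ _ f) => // s t _ _; exact: finj.
Qed.

(** * Dominating, unbounded and unguessable families *)

Lemma infinite_set_natP (P : set nat) :
  infinite_set P <-> forall N, exists2 n, (N <= n)%N & P n.
Proof.
split=> [Pinf N|Pex /finite_seqP[s Ps]].
  apply: contrapT => nP; apply: Pinf.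
  apply: (@sub_finite_set _ _ `I_N); last exact: finite_II.
  move=> n Pn /=; rewrite ltnNge; apply/negP => Nn; apply: nP; by exists n.
have [n nmax] := Pex (\max_(i <- s) i).+1.
rewrite Ps /= => ns; move: nmax; rewrite ltnNge => /negP; apply.
exact: leq_bigmax_seq.
Qed.

(** Each equality of cardinals is proved through this: [lower] carries the lower bound over to [C],
    and [upper] applied to a minimal member of [C0] gives a member of [C] attaining it. *)
Lemma is_min_card_transfer {T U V : Type} (C0 : set (set T)) (K : set U)
    (C : set (set V)) :
  is_min_card C0 K ->
  (forall A, C A -> exists2 A0, C0 A0 & A0 #<= A) ->
  (forall A0, C0 A0 -> exists2 A, C A & A #<= A0) ->
  is_min_card C K.
Proof.
move=> [[A0 CA0 A0K] K_le] lower upper.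
have K_leC A : C A -> K #<= A.
  by move=> /lower[A1 /K_le/card_le_trans]; apply.
split=> //; have [A CA AA0] := upper _ CA0; exists A => //.
by rewrite card_eq_le K_leC// andbT -(card_le_eqr A0K).
Qed.

Lemma exists_min_card {T : Type} (C : set (set T)) :
  C !=set0 -> exists K : set T, is_min_card C K.
Proof.
move=> [A0 CA0].
have [[K CK] Kmin] := exists_card_min (exist C A0 CA0) (fun A => sval A).
exists K; split; first by exists K.
by move=> A CA; exact: (Kmin (exist C A CA)).
Qed.

Lemma countable_le_star_bounded (D : set (nat -> nat)) : countable D ->
  exists g, forall f, D f -> le_star f g.
Proof.
(* A diagonal maximum: from index [k] on, [e k] is among the functions over which it is taken. *)
move=> /pcard_surjP[e De]; exists (fun n => \max_(i < n.+1) e i n)%N.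
move=> _ /De[k _ <-]; exists k => // n /= kn.
exact: (@leq_bigmax _ (fun i : 'I_n.+1 => e i n) (Ordinal (kn : k < n.+1)%N)).
Qed.

Lemma countable_guessable (Y : set (nat -> nat)) : countable Y ->
  exists f : nat -> nat, forall y, Y y -> exists n, f n = y n.
Proof.
move=> /pcard_surjP[e Ye]; exists (fun n => e n n).
by move=> _ /Ye[k _ <-]; exists k.
Qed.

Lemma dominating_unbounded (D : set (nat -> nat)) :
  dominating_family D -> unbounded_family D.
Proof.
move=> Ddom [g gD]; have [f Df [M _ gf]] := Ddom (fun n => (g n).+1).
have [N _ fg] := gD _ Df.
have := leq_trans (gf (maxn M N) (leq_maxl _ _)) (fg (maxn M N) (leq_maxr _ _)).
by rewrite ltnn.
Qed.

Lemma unbounded_infinite (B : set (nat -> nat)) :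
  unbounded_family B -> infinite_set B.
Proof. by move=> Bu /finite_set_countable/countable_le_star_bounded. Qed.

Lemma unguessable_infinite (Y : set (nat -> nat)) :
  unguessable_family Y -> infinite_set Y.
Proof. by move=> Yu /finite_set_countable/countable_guessable. Qed.

Lemma dominating_familyT : dominating_family [set: nat -> nat].
Proof. by move=> g; exists g => //; exists 0%N. Qed.

Lemma unguessable_familyT : unguessable_family [set: nat -> nat].
Proof. by move=> [f /(_ (fun n => (f n).+1) I)[n /n_Sn]]. Qed.

Section indexed_families.
Context {T : choiceType} (A : set T) (phi : T -> nat -> nat).

(** A [g] that no [phi x] eventually dominates is above each [phi x] infinitely often. *)
Lemma dominating_image :
  ~ (exists g, forall x, A x -> infinite_set [set n | (phi x n <= g n)%N]) ->
  dominating_family (phi @` A).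
Proof.
move=> nM g; apply: contrapT => ng; apply: nM; exists g => x Ax.
apply/infinite_set_natP => N; apply: contrapT => nN; apply: ng.
exists (phi x); first by exists x.
exists N => // n /= Nn; rewrite leqNgt; apply/negP => /ltnW le.
by apply: nN; exists n.
Qed.

Lemma unbounded_image :
  ~ (exists g, forall x, A x -> \forall n \near \oo, (phi x n <= g n)%N) ->
  unbounded_family (phi @` A).
Proof. by move=> nH [g gA]; apply: nH; exists g => x Ax; apply: gA; exists x. Qed.

Lemma unguessable_image :
  ~ (exists f, forall x, A x -> exists n, f n = phi x n) ->
  unguessable_family (phi @` A).
Proof. by move=> nR [f fA]; apply: nR; exists f => x Ax; apply: fA; exists x. Qed.

End indexed_families.

Lemma dominating_seq_max {T : choiceType} (A : set T) (phi : T -> nat -> nat) :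
  ~ (exists g, forall E, finite_set E -> E `<=` A ->
       infinite_set [set n | forall x, E x -> (phi x n <= g n)%N]) ->
  exists2 D, dominating_family D & D #<= A.
Proof.
move=> nS; pose psi s n := (\max_(x <- s) phi x n)%N.
have psi_dom : dominating_family (psi @` seqs A).
  apply: dominating_image => -[g gP]; apply: nS; exists g => _ /finite_seqP[s ->] sA.
  apply: sub_infinite_set (gP s _) => [n /= psin x xs|].
    exact: leq_trans (leq_bigmax_seq _ _ _) psin.
  by apply/allP => x xs; apply/mem_set/sA.
(* For finite [A] a single function would eventually bound every [phi x], hence every finite
   maximum, while these maxima form a dominating, so unbounded, family. *)
have Ainf : infinite_set A.
  move=> /finite_set_countable Acount.
  have [g gP] := countable_le_star_bounded
    (card_le_trans (card_image_le phi A) Acount).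
  apply: (dominating_unbounded psi_dom); exists g => _ [s As <-].
  elim: s As => [_|x s IH /seqs_cons[Ax /IH[N _ sg]]].
    by exists 0%N => // n _; rewrite /= /psi big_nil.
  have [M _ xg] := gP _ (imageP phi Ax).
  exists (maxn M N) => // n /=; rewrite geq_max => /andP[Mn Nn].
  by rewrite /psi big_cons geq_max xg//=; exact: sg.
exists (psi @` seqs A) => //.
exact: card_le_trans (card_image_le _ _) (seqs_card_le Ainf).
Qed.

(** * Cylinders and selections *)

Lemma eq_mkseqP {T : Type} (f g : nat -> T) k :
  mkseq f k = mkseq g k <-> forall i, (i < k)%N -> f i = g i.
Proof.
split=> [fg i ik|fg].
  by have := congr1 (fun s => nth (f i) s i) fg; rewrite !nth_mkseq.
apply: (@eq_from_nth _ (f 0)) => [|i]; rewrite !size_mkseq// => ik.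
by rewrite !nth_mkseq// fg.
Qed.

Definition cylinder {T : Type} (v : T -> ZN) (x : T) (k : nat) : set T :=
  [set y | mkseq (v y) k = mkseq (v x) k].

(** The topology of [T] is the one induced by [v], put in terms of cylinders so that subspaces and
    subgroups are handled together. *)
Definition ZN_embedding {T : topologicalType} (v : T -> ZN) : Prop :=
  forall x A, nbhs x A <-> exists k, cylinder v x k `<=` A.

Lemma ZN_embedding_id : ZN_embedding (@id ZN).
Proof.
move=> f A; split; last first.
  move=> [k kA]; suff : nbhs f (cylinder id f k) by move=> h; exact: (filterS kA h).
  elim: k {kA} => [|k IH].
    by apply: filterS filterT => g _.
  apply: filterS (filterI IH (nbhs_ZN_coord f k)) => g [/= fgk fgk'].
  by rewrite /cylinder /= !mkseqS fgk fgk'.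
(* The filter generated by the cylinders at [f] converges to [f] in each coordinate [k], because a
   cylinder of length [k.+1] fixes that coordinate. *)
pose F : set_system ZN := filter_from setT (cylinder id f).
have FF : Filter F.
  apply: filter_from_filter; first by exists 0%N.
  move=> i j _ _; exists (maxn i j) => // g /eq_mkseqP gf.
  by split; apply/eq_mkseqP => k kl; apply: gf; rewrite leq_max kl ?orbT.
suff Ff : F --> f by move=> /Ff[k _ kA]; exists k.
apply/cvg_sup => k U [B [[C _ <-]] /= pC CU].
exists k.+1 => // g /eq_mkseqP gf; apply: CU => /=.
by rewrite /prod_topology /= in g gf *; rewrite gf.
Qed.

Lemma ZN_embedding_initial {T : choiceType} (v : T -> ZN) :
  ZN_embedding (v : initial_topology v -> ZN).
Proof.
move=> x A; split=> [[B [[C Copen <-] Cx CA]]|[k kA]].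
  have [k kC] := (ZN_embedding_id _ _).1 (open_nbhs_nbhs (conj Copen Cx)).
  by exists k; apply: subset_trans CA => y; exact: kC.
apply: (filterS kA).
apply: (@initial_continuous T ZN v x (cylinder id (v x) k)).
by apply/ZN_embedding_id; exists k.
Qed.

Lemma ZN_embedding_set_type (X : set ZN) : ZN_embedding (\val : X -> ZN).
Proof. exact: ZN_embedding_initial. Qed.

Lemma ZN_embedding_subgroup (G : zmodClosed ZN) :
  ZN_embedding (\val : subgroup G -> ZN).
Proof.
exact: (@ZN_embedding_initial _ (\val : {g : ZN | g \in G} -> ZN)).
Qed.

Section selection.
Context {T : topologicalType} (v : T -> ZN) (v_emb : ZN_embedding v).
(** A common form of two situations: for open covers, [J] consists of sets, [P n] is the cover and
    [N n] the identity; for groups, [J] consists of group elements and [N n z] is the translate of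
    the [n]-th neighbourhood by [z]. *)
Context {J : Type} (P : nat -> set J) (N : nat -> J -> set T).
Hypothesis P0 : forall n, P n !=set0.
Hypothesis N_nbhs : forall n (x : T), exists2 i, P n i & nbhs x (N n i).

(* [phi x n] is the code of an initial segment of [v x] whose cylinder lies in
   some [N n i], and [a n m] is such an [i] for the segment of code [m]. *)
Lemma cylinder_coding : exists (a : nat -> nat -> J) (phi : T -> nat -> nat),
  (forall n m, P n (a n m)) /\ forall x n, N n (a n (phi x n)) x.
Proof.
(* [Q n m i] says that [N n i] contains the whole cylinder of the segment with code [m]; for an [m]
   admitting no such [i], [a] takes an arbitrary member of [P n]. *)
pose Q n m i := forall y k, choice.pickle (mkseq (v y) k) = m -> N n i y.
have /choice[a aP] (nm : nat * nat) : exists i, P nm.1 i /\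
    ((exists2 j, P nm.1 j & Q nm.1 nm.2 j) -> Q nm.1 nm.2 i).
  have [[j Pj Qj]|nQ] := pselect (exists2 j, P nm.1 j & Q nm.1 nm.2 j).
    by exists j; split.
  by have [i Pi] := P0 nm.1; exists i.
have /choice[phi phiP] (xn : T * nat) : exists m,
    (exists2 j, P xn.2 j & Q xn.2 m j) /\
    exists k, choice.pickle (mkseq (v xn.1) k) = m.
  have [j Pj /v_emb[k kN]] := N_nbhs xn.2 xn.1.
  exists (choice.pickle (mkseq (v xn.1) k)); split; last by exists k.
  (* The code determines the segment and therefore its length, so [l] must be [k]. *)
  exists j => // y l /(pcan_inj choice.pickleK) yl; apply: kN.
  have lk : l = k by have := congr1 size yl; rewrite !size_mkseq.
  by rewrite -lk in yl *.
exists (fun n m => a (n, m)), (fun x n => phi (x, n)); split.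
  by move=> n m; exact: (aP (n, m)).1.
move=> x n; have [Qex [k kphi]] := phiP (x, n).
exact: ((aP (n, phi (x, n))).2 Qex) kphi.
Qed.

Lemma Scheepers_selection :
  ~ (exists2 D, dominating_family D & D #<= [set: T]) ->
  exists F : nat -> set J, (forall n, finite_set (F n) /\ F n `<=` P n) /\
    forall E : set T, finite_set E -> exists n, E `<=` \bigcup_(i in F n) N n i.
Proof.
move=> nD; have [a [phi [aP aN]]] := cylinder_coding.
apply: contrapT => nF; apply: nD.
apply: (@dominating_seq_max _ _ phi) => -[g gP]; apply: nF.
(* Since [g n] bounds the relevant codes, only the finitely many members attached to codes up to
   [g n] are selected. *)
exists (fun n => a n @` `I_(g n).+1); split=> [n|E Efin].
  by split; [exact: finite_image|move=> _ [m _ <-]].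
have /infinite_set_natP/(_ 0)[n _ nE] := gP E Efin (@subsetT _ E).
by exists n => x Ex; exists (a n (phi x n)) => //; exists (phi x n) => //=;
  rewrite ltnS nE.
Qed.

Lemma Hurewicz_selection :
  ~ (exists2 B, unbounded_family B & B #<= [set: T]) ->
  exists F : nat -> set J, (forall n, finite_set (F n) /\ F n `<=` P n) /\
    forall x : T, \forall n \near \oo, (\bigcup_(i in F n) N n i) x.
Proof.
move=> nB; have [a [phi [aP aN]]] := cylinder_coding.
apply: contrapT => nF; apply: nB.
exists (phi @` setT); last exact: card_image_le.
apply: unbounded_image => -[g gP]; apply: nF.
exists (fun n => a n @` `I_(g n).+1); split=> [n|x].
  by split; [exact: finite_image|move=> _ [m _ <-]].
have [M _ xg] := gP x I; exists M => // n Mn.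
by exists (a n (phi x n)) => //; exists (phi x n) => //=; rewrite ltnS xg.
Qed.

Lemma Rothberger_selection :
  ~ (exists2 Y, unguessable_family Y & Y #<= [set: T]) ->
  exists i : nat -> J, (forall n, P n (i n)) /\ \bigcup_n N n (i n) = setT.
Proof.
move=> nY; have [a [phi [aP aN]]] := cylinder_coding.
apply: contrapT => nF; apply: nY.
exists (phi @` setT); last exact: card_image_le.
apply: unguessable_image => -[f fP]; apply: nF.
exists (fun n => a n (f n)); split=> [n //|].
by rewrite -subTset => x _; have [n fn] := fP x I; exists n => //; rewrite fn.
Qed.

End selection.

Local Open Scope ring_scope.

(** * Covering properties of spaces *)

Section non_spaces.
Context {T : topologicalType} (v : T -> ZN) (v_emb : ZN_embedding v).

Lemma open_cover_nbhs (U : set (set T)) (x : T) :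
  open_cover U -> exists2 V, U V & nbhs x V.
Proof.
move=> [_ Uopen UT]; have [V UV Vx] : (\bigcup_(V in U) V) x by rewrite UT.
by exists V => //; apply: open_nbhs_nbhs; split => //; exact: Uopen.
Qed.

Lemma non_Scheepers :
  ~ Scheepers T -> exists2 D, dominating_family D & D #<= [set: T].
Proof.
move=> nS; apply: contrapT => nD; apply: nS => U Ucover.
apply: (@Scheepers_selection _ _ v_emb _ U (fun=> id) _ _ nD) => [n|n x].
  by have [] := Ucover n.
exact: open_cover_nbhs.
Qed.

Lemma non_Hurewicz :
  ~ Hurewicz T -> exists2 B, unbounded_family B & B #<= [set: T].
Proof.
move=> nH; apply: contrapT => nB; apply: nH => U Ucover.
apply: (@Hurewicz_selection _ _ v_emb _ U (fun=> id) _ _ nB) => [n|n x].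
  by have [] := Ucover n.
exact: open_cover_nbhs.
Qed.

Lemma non_Rothberger :
  ~ Rothberger T -> exists2 Y, unguessable_family Y & Y #<= [set: T].
Proof.
move=> nR; apply: contrapT => nY; apply: nR => U Ucover.
apply: (@Rothberger_selection _ _ v_emb _ U (fun=> id) _ _ nY) => [n|n x].
  by have [] := Ucover n.
exact: open_cover_nbhs.
Qed.

Lemma Scheepers_Menger : Scheepers T -> Menger T.
Proof.
move=> S U /S[F [FU FE]]; exists F; split => //; rewrite -subTset => x _.
by have [n /(_ x erefl)] := FE [set x] (finite_set1 x); exists n.
Qed.

Hypothesis T0 : [set: T] !=set0.

(** A point of [T] is used to make the family nonempty, as [open_cover] demands. *)
Lemma cylinder_open_cover (k : nat) :
  open_cover (range (fun x => cylinder v x k)).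
Proof.
have [t0 _] := T0; split; first by exists (cylinder v t0 k), t0.
  move=> _ [x _ <-]; rewrite openE => y yx; apply/v_emb; exists k => z zy.
  by rewrite /cylinder/= in yx zy *; rewrite zy.
by rewrite -subTset => x _; exists (cylinder v x k) => //; exists x.
Qed.

(** Replacing the selected cylinders by their centres brings selections from covers to the form in
    which boundedness of groups yields them. *)
Let centers (F : set (set T)) (k : nat) :
  F `<=` range (fun x => cylinder v x k) -> finite_set F ->
  exists E : set T, finite_set E /\
    forall x, (\bigcup_(V in F) V) x -> exists2 a, E a & cylinder v a k x.
Proof.
move=> FC Ffin; have [t0 _] := T0.
have /choice[c cP] V : exists a, F V -> cylinder v a k = V.
  have [/FC[a _ aV]|nFV] := pselect (F V); first by exists a.
  by exists t0.
exists (c @` F); split; first exact: finite_image.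
by move=> x [V FV Vx]; exists (c V); [exists V|rewrite cP].
Qed.

Lemma Menger_cylinders : Menger T -> forall h : nat -> nat,
  exists F : nat -> set T, (forall n, finite_set (F n)) /\
    forall x, exists n, exists2 a, F n a & cylinder v a (h n) x.
Proof.
move=> M h; have [F [FU FT]] := M _ (fun n => cylinder_open_cover (h n)).
have /choice[E EP] n := centers (FU n).2 (FU n).1.
exists E; split=> [n|x]; first exact: (EP n).1.
have [n _ Fx] : (\bigcup_n \bigcup_(V in F n) V) x by rewrite FT.
by exists n; exact: (EP n).2.
Qed.

Lemma Hurewicz_cylinders : Hurewicz T -> forall h : nat -> nat,
  exists F : nat -> set T, (forall n, finite_set (F n)) /\
    forall x, \forall n \near \oo, exists2 a, F n a & cylinder v a (h n) x.
Proof.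
move=> H h; have [F [FU FT]] := H _ (fun n => cylinder_open_cover (h n)).
have /choice[E EP] n := centers (FU n).2 (FU n).1.
exists E; split=> [n|x]; first exact: (EP n).1.
by have [M _ Fx] := FT x; exists M => // n /Fx; exact: (EP n).2.
Qed.

Lemma Rothberger_cylinders : Rothberger T -> forall h : nat -> nat,
  exists a : nat -> T, forall x, exists n, cylinder v (a n) (h n) x.
Proof.
move=> R h; have [V [VU VT]] := R _ (fun n => cylinder_open_cover (h n)).
have /choice[a aV] n : exists a, cylinder v a (h n) = V n.
  by have [a _ aV] := VU n; exists a.
exists a => x; have [n _ Vx] : (\bigcup_n V n) x by rewrite VT.
by exists n; rewrite aV.
Qed.

End non_spaces.

(** * Boundedness of subgroups as topological groups *)

Section non_groups.
Variable G : zmodClosed ZN.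
Let v : subgroup G -> ZN := \val.

Lemma nbhs0_cylinder (k : nat) : nbhs (0 : subgroup G) (cylinder v 0 k).
Proof. by apply/ZN_embedding_subgroup; exists k. Qed.

Lemma cylinder_translate (a u : subgroup G) (k : nat) :
  cylinder v 0 k u -> cylinder v a k (a + u).
Proof.
move=> /eq_mkseqP u0; apply/eq_mkseqP => i ik.
transitivity (v a i + v u i); first by [].
by rewrite u0//= addr0.
Qed.

Lemma translates_nbhs (U : set (subgroup G)) (x : subgroup G) :
  nbhs (0 : subgroup G) U -> nbhs x (translates [set x] U).
Proof.
move=> /ZN_embedding_subgroup[k kU]; apply/ZN_embedding_subgroup.
exists k => y /eq_mkseqP yx; exists x => //; exists (y - x); last by rewrite subrKC.
apply: kU; apply/eq_mkseqP => i /yx yxi.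
transitivity (v y i - v x i); first by [].
by rewrite (yxi : v y i = v x i) subrr.
Qed.

Lemma translates_bigcup (F U : set (subgroup G)) :
  \bigcup_(a in F) translates [set a] U `<=` translates F U.
Proof. by move=> _ [a Fa [_ -> [u Uu <-]]]; exists a => //; exists u. Qed.

Lemma non_grp_Scheepers_bounded : ~ grp_Scheepers_bounded (subgroup G) ->
  exists2 D, dominating_family D & D #<= [set: subgroup G].
Proof.
move=> nS; apply: contrapT => nD; apply: nS => U U0.
have [|n x|F [FP FE]] := @Scheepers_selection _ _ (@ZN_embedding_subgroup G) _
    (fun=> setT) (fun n z => translates [set z] (U n)) _ _ nD.
- by exists 0.
- by exists x => //; exact: translates_nbhs.
exists F; split=> [n|E /FE[n En]]; first exact: (FP n).1.
by exists n; apply: subset_trans En _; exact: translates_bigcup.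
Qed.

Lemma non_grp_Hurewicz_bounded : ~ grp_Hurewicz_bounded (subgroup G) ->
  exists2 B, unbounded_family B & B #<= [set: subgroup G].
Proof.
move=> nH; apply: contrapT => nB; apply: nH => U U0.
have [|n x|F [FP FE]] := @Hurewicz_selection _ _ (@ZN_embedding_subgroup G) _
    (fun=> setT) (fun n z => translates [set z] (U n)) _ _ nB.
- by exists 0.
- by exists x => //; exact: translates_nbhs.
exists F; split=> [n|x]; first exact: (FP n).1.
by have [M _ xM] := FE x; exists M => // n /xM; exact: translates_bigcup.
Qed.

Lemma non_grp_Rothberger_bounded : ~ grp_Rothberger_bounded (subgroup G) ->
  exists2 Y, unguessable_family Y & Y #<= [set: subgroup G].
Proof.
move=> nR; apply: contrapT => nY; apply: nR => U U0.
have [|n x|a [_ aT]] := @Rothberger_selection _ _ (@ZN_embedding_subgroup G) _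
    (fun=> setT) (fun n z => translates [set z] (U n)) _ _ nY.
- by exists 0.
- by exists x => //; exact: translates_nbhs.
by exists a.
Qed.

Lemma grp_Scheepers_Menger :
  grp_Scheepers_bounded (subgroup G) -> grp_Menger_bounded (subgroup G).
Proof.
move=> S U /S[F [Ffin FE]]; exists F; split => //; rewrite -subTset => x _.
by have [n /(_ x erefl)] := FE [set x] (finite_set1 x); exists n.
Qed.

Lemma grp_Menger_cylinders : grp_Menger_bounded (subgroup G) ->
  forall h : nat -> nat, exists F : nat -> set (subgroup G),
    (forall n, finite_set (F n)) /\
    forall x, exists n, exists2 a, F n a & cylinder v a (h n) x.
Proof.
move=> M h; have [F [Ffin FT]] := M _ (fun n => nbhs0_cylinder (h n)).
exists F; split=> // x.
have [n _ [a Fa [u u0 <-]]] : (\bigcup_n translates (F n) (cylinder v 0 (h n))) x.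
  by rewrite FT.
by exists n, a => //; exact: cylinder_translate.
Qed.

Lemma grp_Hurewicz_cylinders : grp_Hurewicz_bounded (subgroup G) ->
  forall h : nat -> nat, exists F : nat -> set (subgroup G),
    (forall n, finite_set (F n)) /\
    forall x, \forall n \near \oo, exists2 a, F n a & cylinder v a (h n) x.
Proof.
move=> H h; have [F [Ffin FT]] := H _ (fun n => nbhs0_cylinder (h n)).
exists F; split=> // x; have [M _ xM] := FT x; exists M => // n /xM.
by move=> [a Fa [u u0 <-]]; exists a => //; exact: cylinder_translate.
Qed.

Lemma grp_Rothberger_cylinders : grp_Rothberger_bounded (subgroup G) ->
  forall h : nat -> nat, exists a : nat -> subgroup G,
    forall x, exists n, cylinder v (a n) (h n) x.
Proof.
move=> R h; have [a aT] := R _ (fun n => nbhs0_cylinder (h n)).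
exists a => x.
have [n _ [_ -> [u u0 <-]]] :
    (\bigcup_n translates [set a n] (cylinder v 0 (h n))) x by rewrite aT.
by exists n; exact: cylinder_translate.
Qed.

End non_groups.

(** * Bounded sets and generated subgroups *)

Lemma finite_set_leq_bound {T : Type} (A : set T) (u : T -> nat) :
  finite_set A -> exists b, forall a, A a -> (u a <= b)%N.
Proof.
move=> /(finite_image u)/finite_seqP[s us]; exists (\max_(i <- s) i)%N => a Aa.
apply: (@leq_bigmax_seq _ s xpredT id) => //.
by have : (u @` A) (u a) by [exists a]; rewrite us.
Qed.

Section bounded_sets.
Context {T : Type} (v : T -> ZN) (X : set ZN).
Hypothesis Xv : X `<=` range v.

Lemma Menger_bounded_cylinders :
  (forall h : nat -> nat, exists F : nat -> set T, (forall n, finite_set (F n)) /\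
    forall x, exists n, exists2 a, F n a & cylinder v a (h n) x) ->
  Menger_bounded X.
Proof.
(* The selection made for [fun n => m + n], for every [m], yields infinitely
   many good indices. *)
move=> cyl; have /choice[F FP] m := cyl (addn m).
pose u N a := (\max_(k < N) absz (v a k))%N.
have /choice[b bP] mn : exists b, forall a, F mn.1 mn.2 a ->
    (u (mn.1 + mn.2)%N a <= b)%N.
  exact: finite_set_leq_bound ((FP mn.1).1 mn.2).
(* The bound at [N] is the maximum over all splittings [N = m + n]; the index [n] found for [m] then
   gives a good [N = m + n], which is at least [m]. *)
exists (fun N => \max_(m < N.+1) b (nat_of_ord m, (N - m)%N))%N.
move=> _ /Xv[x _ <-]; apply/infinite_set_natP => m.
have [n [a Fa /eq_mkseqP xa]] := (FP m).2 x.
exists (m + n)%N => [|k kmn]; first exact: leq_addr.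
rewrite xa//; apply: (@leq_trans (u (m + n)%N a)).
  exact: (@leq_bigmax _ (fun k : 'I_(m + n) => absz (v a k)) (Ordinal kmn)).
apply: leq_trans (bP (m, n) a Fa) _.
have mmn : (m < (m + n).+1)%N by rewrite ltnS leq_addr.
apply: leq_trans (@leq_bigmax _ (fun i : 'I_(m + n).+1 =>
  b (nat_of_ord i, (m + n - i)%N)) (Ordinal mmn)).
by rewrite /= addKn.
Qed.

Lemma Hurewicz_bounded_cylinders :
  (forall h : nat -> nat, exists F : nat -> set T, (forall n, finite_set (F n)) /\
    forall x, \forall n \near \oo, exists2 a, F n a & cylinder v a (h n) x) ->
  Hurewicz_bounded X.
Proof.
(* Segments of length [n.+1] are the shortest that contain coordinate [n]. *)
move=> /(_ succn)[F [Ffin FP]].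
have /choice[f fP] n := finite_set_leq_bound (fun a => absz (v a n)) (Ffin n).
exists f => _ /Xv[x _ <-]; have [M _ xM] := FP x; exists M => // n /xM.
by move=> [a Fa /eq_mkseqP xa]; rewrite /= xa//; exact: fP.
Qed.

Lemma Rothberger_bounded_cylinders :
  (forall h : nat -> nat, exists a : nat -> T, forall x, exists n,
    cylinder v (a n) (h n) x) ->
  Rothberger_bounded X.
Proof.
move=> cyl h _; have [a aP] := cyl h; exists (fun n => mkseq (v (a n)) (h n)).
by move=> _ /Xv[x _ <-]; exact: aP.
Qed.

Lemma Scheepers_Menger_bounded : Scheepers_bounded X -> Menger_bounded X.
Proof.
move=> [f fP]; exists f => g Xg; apply: sub_infinite_set (fP [set g] _ _) => //.
  by move=> n gn k; exact: gn.
by move=> _ ->.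
Qed.

Lemma non_Scheepers_bounded :
  ~ Scheepers_bounded X -> exists2 D, dominating_family D & D #<= X.
Proof.
move=> nS; apply: (@dominating_seq_max _ _
  (fun g n => \max_(k < n) absz (g (nat_of_ord k)))%N) => -[f fP].
apply: nS; exists f => F Ffin FX; apply: sub_infinite_set (fP F Ffin FX).
move=> n Fn g k Fg kn; apply: leq_trans (Fn g Fg).
exact: (@leq_bigmax _ (fun k : 'I_n => absz (g k)) (Ordinal kn)).
Qed.

Lemma non_Hurewicz_bounded :
  ~ Hurewicz_bounded X -> exists2 B, unbounded_family B & B #<= X.
Proof.
move=> nH; exists ((fun g n => absz (g n)) @` X); last exact: card_image_le.
by apply: unbounded_image.
Qed.

Lemma non_Rothberger_bounded :
  ~ Rothberger_bounded X -> exists2 Y, unguessable_family Y & Y #<= X.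
Proof.
move=> nR; apply: contrapT => nY; apply: nR => h _; apply: contrapT => nphi.
apply: nY; exists ((fun g n => choice.pickle (mkseq g (h n))) @` X);
  last exact: card_image_le.
apply: unguessable_image => -[f fP]; apply: nphi.
(* The guessed number is decoded into a segment; numbers that code nothing give the empty
   sequence. *)
exists (fun n => odflt [::] (choice.unpickle (f n))) => g /fP[n fn].
by exists n; rewrite fn choice.pickleK.
Qed.

End bounded_sets.

(** * Unbounded sets and the subgroups they generate *)

Definition ZN_of_nat (f : nat -> nat) : ZN := fun n => Posz (f n).

Lemma not_Menger_bounded (D : set (nat -> nat)) (X : set ZN) :
  dominating_family D -> ZN_of_nat @` D `<=` X -> ~ Menger_bounded X.
Proof.
(* A good index [n.+1] bounds the entry at [n] by [f n.+1], so the function to dominate is [f]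
   shifted by one and increased by one. *)
move=> Ddom DX [f fP]; have [g Dg [N _ fg]] := Ddom (fun k => (f k.+1).+1).
have /infinite_set_natP/(_ N.+1) := fP _ (DX _ (imageP _ Dg)).
move=> [[|n] // Nn /(_ n (leqnn _))/= gf].
by have := leq_trans (fg n Nn) gf; rewrite ltnn.
Qed.

Lemma not_Hurewicz_bounded (B : set (nat -> nat)) (X : set ZN) :
  unbounded_family B -> ZN_of_nat @` B `<=` X -> ~ Hurewicz_bounded X.
Proof.
move=> Bunb BX [f fP]; apply: Bunb; exists f => g Bg.
exact: (fP _ (BX _ (imageP _ Bg))).
Qed.

Lemma not_Rothberger_bounded (Y : set (nat -> nat)) (X : set ZN) :
  unguessable_family Y -> ZN_of_nat @` Y `<=` X -> ~ Rothberger_bounded X.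
Proof.
move=> Yung YX Rb; apply: Yung.
have [|phi phiP] := Rb succn; first by move=> m n.
(* If [phi n] is the segment of length [n.+1] of a member, its last entry is the value at [n], which
   makes this a guess of that value. *)
exists (fun n => absz (nth 0 (phi n) n)) => y Yy.
have [n phin] := phiP _ (YX _ (imageP _ Yy)); exists n.
by rewrite -phin nth_mkseq.
Qed.

(** This is the subgroup generated by [A], presented so that pairs of sequences over [A] index its
    elements. *)
Definition sum_differences (A : set ZN) : {pred ZN} :=
  mem [set g : ZN | exists2 st : seq ZN * seq ZN, seqs A st.1 /\ seqs A st.2 &
    g = \sum_(x <- st.1) x - \sum_(x <- st.2) x].

Lemma sum_differences_zmod_closed (A : set ZN) :
  zmod_closed (sum_differences A).
Proof.
split.
  by apply/mem_set; exists ([::], [::]) => //=; rewrite big_nil subrr.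
move=> _ _ /set_mem[[s t] [/= As At] ->] /set_mem[[s' t'] [/= As' At'] ->].
apply/mem_set; exists (s ++ t', t ++ s') => /=.
  by split; rewrite /seqs /= all_cat; exact/andP.
by rewrite !big_cat/= opprB addrACA opprD.
Qed.

HB.instance Definition _ (A : set ZN) :=
  GRing.isZmodClosed.Build ZN (sum_differences A) (sum_differences_zmod_closed A).

Lemma generated_subgroup (A : set ZN) : infinite_set A ->
  exists G : zmodClosed ZN, A `<=` [set` G] /\ [set` G] #<= A.
Proof.
move=> Ainf; exists (sum_differences A : zmodClosed ZN); split=> [x Ax|].
  apply/mem_set; exists ([:: x], [::]); first by split; [apply/seqs_cons|].
  by rewrite big_seq1 big_nil subr0.
have [a0 _] := infinite_setN0 Ainf.
have [c [cA cinj]] := card_le_injP a0 (seqs_card_le Ainf).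
apply: (@card_le_trans _ _ _ ([set s | seqs A s] `*` [set s | seqs A s])).
  apply: card_le_trans (card_image_le
    (fun st : seq ZN * seq ZN => \sum_(x <- st.1) x - \sum_(x <- st.2) x) _).
  by apply: subset_card_le => g /set_mem[st Ast ->]; exists st.
apply: card_le_trans (seqs_card_le Ainf).
(* A pair of sequences becomes a two-term sequence over [A], so the bound on [seqs A] is used
   twice. *)
apply: (@card_le_inj _ _ _ _ (fun st => [:: c st.1; c st.2])).
  move=> [s t] [/= As At]; apply/seqs_cons; split; first exact: cA.
  by apply/seqs_cons; split => //; exact: cA.
move=> [s t] [s' t'] [/= As At] [/= As' At'] [] /cinj-/(_ As As')->.
by move=> /cinj-/(_ At At')->.
Qed.

(* [Q0] is the property refuted for generated subgroups; it is weaker than [Q]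
   only for Scheepers-boundedness, where it is Menger-boundedness. *)
Lemma is_min_card_properties (C0 : set (set (nat -> nat))) (K : set (nat -> nat))
    (P : topologicalType -> Prop) (Q Q0 : set ZN -> Prop)
    (R : topologicalZmodType -> Prop) :
  is_min_card C0 K -> (forall A, C0 A -> infinite_set A) ->
  (forall (T : topologicalType) (v : T -> ZN), ZN_embedding v -> ~ P T ->
    exists2 A, C0 A & A #<= [set: T]) ->
  (forall X, ~ Q X -> exists2 A, C0 A & A #<= X) ->
  (forall G : zmodClosed ZN, ~ R (subgroup G) ->
    exists2 A, C0 A & A #<= [set: subgroup G]) ->
  (forall A X, C0 A -> ZN_of_nat @` A `<=` X -> ~ Q0 X) ->
  (forall X : set ZN, X !=set0 -> P X -> Q0 X) ->
  (forall X, Q X -> Q0 X) ->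
  (forall G : zmodClosed ZN, R (subgroup G) -> Q0 [set` G]) ->
  [/\ is_min_card (non_space P) K, is_min_card (non Q) K &
      is_min_card (non_grp R) K].
Proof.
move=> Kmin C0inf nP nQ nR nQ0 PQ0 QQ0 RQ0.
(* A single generated subgroup serves as the small counterexample for all three minima. *)
have witness A : C0 A -> exists G : zmodClosed ZN,
    [/\ ZN_of_nat @` A `<=` [set` G], [set` G] #<= A & ~ Q0 [set` G]].
  move=> CA; have natA : ZN_of_nat @` A #= A.
    apply: inj_card_eq => f g _ _ fg; apply/funext => n.
    by have [] := congr1 (@^~ n) fg.
  have [|G [AG GA]] := @generated_subgroup (ZN_of_nat @` A).
    by rewrite (eq_finite_set natA); exact: C0inf.
  by exists G; split=> //; [rewrite -(card_le_eqr natA)|exact: nQ0 AG].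
split; apply: (is_min_card_transfer Kmin).
- move=> X /(nP _ _ (@ZN_embedding_set_type X))[A CA AX].
  by exists A => //; rewrite -(card_le_eqr (card_setT X)).
- move=> A /[dup] CA /witness[G [_ GA nQ0G]]; exists [set` G] => //.
  (* The implication for spaces asks for a nonempty set, and a subgroup contains 0. *)
  by move=> /PQ0 Q0G; apply/nQ0G/Q0G; exists 0; exact: rpred0.
- by [].
- by move=> A /witness[G [_ GA nQ0G]]; exists [set` G] => // /QQ0.
- move=> _ [G <- /nR[A CA AG]]; exists A => //; apply: card_le_trans AG _.
  apply: (@card_le_inj _ _ _ _ (\val : subgroup G -> ZN)) => [x _|x y _ _].
    exact: valP.
  exact: val_inj.
- move=> A /witness[G [_ GA nQ0G]]; exists [set` G] => //; exists G => //.
  by move=> /RQ0.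
Qed.

Lemma sub_range_set_type (X : set ZN) : X `<=` range (\val : X -> ZN).
Proof. by move=> x Xx; exists (exist _ x (mem_set Xx)). Qed.

Lemma sub_range_subgroup (G : zmodClosed ZN) :
  [set` G] `<=` range (\val : subgroup G -> ZN).
Proof. by move=> x Gx; exists (exist _ x Gx). Qed.

Lemma set_typeT (X : set ZN) : X !=set0 -> [set: X] !=set0.
Proof. by move=> [x Xx]; exists (exist _ x (mem_set Xx)). Qed.

Theorem corollary6p1 :
  (exists d : set (nat -> nat), is_d d /\
    [/\ is_min_card (non_space Menger) d,
        is_min_card (non Menger_bounded) d &
        is_min_card (non_grp grp_Menger_bounded) d] /\
    [/\ is_min_card (non_space Scheepers) d,
        is_min_card (non Scheepers_bounded) d &
        is_min_card (non_grp grp_Scheepers_bounded) d]) /\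
  (exists b : set (nat -> nat), is_b b /\
    [/\ is_min_card (non_space Hurewicz) b,
        is_min_card (non Hurewicz_bounded) b &
        is_min_card (non_grp grp_Hurewicz_bounded) b]) /\
  (exists c : set (nat -> nat), is_cov_meager c /\
    [/\ is_min_card (non_space Rothberger) c,
        is_min_card (non Rothberger_bounded) c &
        is_min_card (non_grp grp_Rothberger_bounded) c]).
Proof.
have space_Menger (X : set ZN) : X !=set0 -> Menger X -> Menger_bounded X.
  move=> /set_typeT X0 /(Menger_cylinders (@ZN_embedding_set_type X) X0).
  exact: (Menger_bounded_cylinders (@sub_range_set_type X)).
have grp_Menger (G : zmodClosed ZN) :
    grp_Menger_bounded (subgroup G) -> Menger_bounded [set` G].
  move=> /grp_Menger_cylinders.
  exact: (Menger_bounded_cylinders (@sub_range_subgroup G)).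
have dominating_infinite D : dominating_family D -> infinite_set D.
  by move=> /dominating_unbounded/unbounded_infinite.
split; last split.
- have [|d dmin] := @exists_min_card _ dominating_family.
    by exists setT; exact: dominating_familyT.
  exists d; split=> //; split;
    apply: (is_min_card_properties (Q0 := Menger_bounded) dmin) => //.
  + move=> T v v_emb nM; apply: (non_Scheepers v_emb).
    by move=> /Scheepers_Menger.
  + by move=> X nM; apply: non_Scheepers_bounded => /Scheepers_Menger_bounded.
  + move=> G nM; apply: non_grp_Scheepers_bounded.
    by move=> /grp_Scheepers_Menger.
  + exact: not_Menger_bounded.
  + by move=> T v v_emb; exact: (non_Scheepers v_emb).
  + exact: non_Scheepers_bounded.
  + exact: non_grp_Scheepers_bounded.
  + exact: not_Menger_bounded.
  + by move=> X X0 /Scheepers_Menger; exact: space_Menger.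
  + exact: Scheepers_Menger_bounded.
  + by move=> G /grp_Scheepers_Menger; exact: grp_Menger.
- have [|b bmin] := @exists_min_card _ unbounded_family.
    by exists setT; exact/dominating_unbounded/dominating_familyT.
  exists b; split=> //;
    apply: (is_min_card_properties (Q0 := Hurewicz_bounded) bmin) => //.
  + exact: unbounded_infinite.
  + by move=> T v v_emb; exact: (non_Hurewicz v_emb).
  + exact: non_Hurewicz_bounded.
  + exact: non_grp_Hurewicz_bounded.
  + exact: not_Hurewicz_bounded.
  + move=> X /set_typeT X0 /(Hurewicz_cylinders (@ZN_embedding_set_type X) X0).
    exact: (Hurewicz_bounded_cylinders (@sub_range_set_type X)).
  + move=> G /grp_Hurewicz_cylinders.
    exact: (Hurewicz_bounded_cylinders (@sub_range_subgroup G)).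
- have [|c cmin] := @exists_min_card _ unguessable_family.
    by exists setT; exact: unguessable_familyT.
  exists c; split=> //;
    apply: (is_min_card_properties (Q0 := Rothberger_bounded) cmin) => //.
  + exact: unguessable_infinite.
  + by move=> T v v_emb; exact: (non_Rothberger v_emb).
  + exact: non_Rothberger_bounded.
  + exact: non_grp_Rothberger_bounded.
  + exact: not_Rothberger_bounded.
  + move=> X /set_typeT X0 /(Rothberger_cylinders (@ZN_embedding_set_type X) X0).
    exact: (Rothberger_bounded_cylinders (@sub_range_set_type X)).
  + move=> G /grp_Rothberger_cylinders.
    exact: (Rothberger_bounded_cylinders (@sub_range_subgroup G)).
Qed.
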